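(* Let $(P_i)_{i\in I}$ be any family of nonempty countable meet-continuous dcpos, each of which is an $L$-dcpo. Then \[ \sigma\Bigl(\prod_{i\in I}P_i\Bigr)=\prod_{i\in I}\sigma(P_i) \] holds if and only if the set $I_0=\{i\in I:P_i\text{ has no least element}\}$ is finite. Neither $I$ nor the whole product is required to be countable. Moreover, the necessity of the finiteness condition holds for arbitrary nonempty $L$-dcpos: if $(P_i)_{i\in I}$ is any family of nonempty $L$-dcpos (with no countability or meet-continuity assumption) satisfying the displayed equality, then $I_0$ is finite.
   Context: Directed sets are nonempty; countable sets may be finite; arbitrary products are taken in the usual set theory with choice. A subset $D$ of a poset is directed if any two of its elements have a common upper bound in $D$. A dcpo is a poset in which every directed subset has a supremum. Write $\mathord{\downarrow}x=\{y:y\le x\}$ and $\mathord{\downarrow}A=\bigcup_{a\in A}\mathord{\downarrow}a$. For a dcpo $P$, an upper set $U\subseteq P$ is Scott open if for every directed $D\subseteq P$, $\bigvee D\in U$ implies $D\cap U\neq\emptyset$; the Scott open sets form the Scott topology $\sigma(P)$. A dcpo $P$ is meet-continuous if for every $x\in P$ and every directed $D\subseteq P$, $x\le\bigvee D$ implies $x\in\operatorname{cl}_{\sigma(P)}(\mathord{\downarrow}x\cap\mathord{\downarrow}D)$, where $\operatorname{cl}_{\sigma(P)}$ is closure in the Scott topology. A dcpo $P$ is an $L$-dcpo if every principal ideal $\mathord{\downarrow}r$, $r\in P$, is a complete lattice in its induced order (suprema and infima of all subsets, including the empty one, exist inside $\mathord{\downarrow}r$). A global least element is not required. $\prod_i P_i$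 carries the coordinatewise order, $\sigma(\prod_i P_i)$ is its Scott topology, and $\prod_i\sigma(P_i)$ denotes the ordinary topological (Tychonoff) product of the Scott topologies. *)

(* Defs.v *)
From HB Require Import structures.
From mathcomp Require Import all_boot all_order.
From mathcomp Require Import boolp classical_sets cardinality topology.

Set Implicit Arguments.
Unset Strict Implicit.
Unset Printing Implicit Defensive.

Import Order.TTheory.
Local Open Scope classical_set_scope.
Local Open Scope order_scope.

(* Posets are MathComp's [porderType]s: under the classical axioms of
   [mathcomp.classical.boolp] every poset carries such a structure, so the
   boolean order and the choice structure are no restriction. Suprema of a set
   [A] are given by the library's [isLub A]. *)

Section Dcpo.
Context {d : Order.disp_t} {T : porderType d}.
Implicit Types (x y r s : T) (A B D U : set T).

Definition directed D :=
  D !=set0 /\ forall x y, D x -> D y -> exists z, [/\ D z, x <= z & y <= z].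

Definition upper_set U := forall x y, U x -> x <= y -> U y.

Definition scott_open U :=
  upper_set U /\
  forall D s, directed D -> isLub D s -> U s -> D `&` U !=set0.

Definition ideal r : set T := [set y | y <= r].

(* [A] with the induced order is a complete lattice: bounds, suprema and infima
   are all computed inside [A]. *)
Definition complete_lattice A := forall B, B `<=` A ->
  (exists s, (A `&` ubound B) s /\ lbound (A `&` ubound B) s) /\
  (exists m, (A `&` lbound B) m /\ ubound (A `&` lbound B) m).

Lemma scott_openT : scott_open setT.
Proof. by split=> // D s [[x Dx] _] _ _; exists x. Qed.

Lemma scott_openI : setI_closed scott_open.
Proof.
move=> U V [upU oU] [upV oV]; split.
  by move=> x y [Ux Vx] xy; split; [exact: upU xy|exact: upV xy].
move=> D s dirD Ds [Us Vs].
have [x [Dx Ux]] := oU D s dirD Ds Us.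
have [y [Dy Vy]] := oV D s dirD Ds Vs.
have [z [Dz xz yz]] := dirD.2 x y Dx Dy.
by exists z; split=> //; split; [exact: upU xz|exact: upV yz].
Qed.

Lemma scott_open_bigcup (I : Type) (f : I -> set T) :
  (forall i, scott_open (f i)) -> scott_open (\bigcup_i f i).
Proof.
move=> of_; split.
  by move=> x y [i _ fx] xy; exists i => //; exact: (of_ i).1 xy.
move=> D s dirD Ds [i _ fs].
by have [x [Dx fx]] := (of_ i).2 D s dirD Ds fs; exists x; split=> //; exists i.
Qed.

End Dcpo.

(* The poset [T] regarded as a topological space with its Scott topology. *)
Definition scott (T : Type) : Type := T.

HB.instance Definition _ (T : choiceType) := Choice.on (scott T).

HB.instance Definition _ d (T : porderType d) :=
  isOpenTopological.Build (scott T)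
    (@scott_openT d T) (@scott_openI d T) (@scott_open_bigcup d T).

Definition dcpo d (T : porderType d) :=
  forall D : set T, directed D -> exists s, isLub D s.

(* To be used together with [dcpo T]; [closure] is taken in the Scott
   topology and [down D] is the lower closure of [D]. *)
Definition meet_continuous d (T : porderType d) :=
  forall (x : T) (D : set T) (s : T), directed D -> isLub D s -> x <= s ->
    closure (ideal x `&` down D : set (scott T)) x.

Definition L_dcpo d (T : porderType d) :=
  dcpo T /\ forall r : T, complete_lattice (ideal r).

Definition has_least d (T : porderType d) := exists b : T, forall x, b <= x.

(* The coordinatewise order on a dependent product. *)
Definition prod_order {I : Type} (P : I -> Type) : Type := forall i, P i.

HB.instance Definition _ (I : Type) (P : I -> choiceType) :=
  Choice.on (prod_order P).

Section ProdOrder.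
Context {d : Order.disp_t} {I : Type} {P : I -> porderType d}.
Implicit Types f g h : prod_order P.

Definition prod_le f g := `[< forall i, f i <= g i >].

Lemma prod_le_refl : reflexive prod_le.
Proof. by move=> f; apply/asboolP. Qed.

Lemma prod_le_anti : antisymmetric prod_le.
Proof.
move=> f g /andP[/asboolP fg /asboolP gf].
by apply: functional_extensionality_dep => i; apply: le_anti; rewrite fg gf.
Qed.

Lemma prod_le_trans : transitive prod_le.
Proof.
move=> g f h /asboolP fg /asboolP gh; apply/asboolP => i.
exact: le_trans (fg i) (gh i).
Qed.

HB.instance Definition _ := Order.Le_isPOrder.Build d (prod_order P)
  prod_le_refl prod_le_anti prod_le_trans.

End ProdOrder.

(* The Scott topology of the product and the Tychonoff product of the Scott
   topologies are the same families of subsets of [forall i, P i]. *)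
Definition scott_prod_eq d (I : Type) (P : I -> porderType d) :=
  @open (scott (prod_order P)) = @open (prod_topology (fun i => scott (P i))).

(* Main.v *)
(* Necessity. In an L-dcpo every element lies above exactly one minimal element,
   and the filter generated by a family [a] of minimal elements is Scott open in
   the product. If it is Tychonoff open, it constrains finitely many
   coordinates, so [a i] must be least in [P i] for all other [i].

   Sufficiency. Let [W] be Scott open and [f] in [W]. The elements that agree
   with [f] on a finite set of coordinates containing [I_0] and are least
   elsewhere form a directed set with supremum [f], so one of them, [r], is in
   [W]. Its principal ideal is a countable meet-continuous complete lattice, and
   in such a lattice every Scott open neighbourhood of the top contains a Scott
   open filter [F] with the same property. As [F] is closed under finite meets,
   it contains the meets of tuples from its one-coordinate slices, which generate
   Scott open sets in the factors; their box is a neighbourhood of [f] in [W].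

   To get [F], take a decreasing sequence [u] in [W] that is generic for the
   countably many questions "[v <= y \/ w]?". If a directed [D] with supremum
   above some [u n] missed the filter generated by [u], then interleaving [D]
   with [u] would give elements [p j] below [u (m j)] and below [e j] in [D], but
   not below [e (j - 1) \/ u (m (j + 1))]. Then distinct subsets of [p] have
   distinct suprema, contradicting countability. *)

Require Import Defs.
From mathcomp Require Import all_boot all_order.
From mathcomp Require Import boolp classical_sets cardinality topology.

Set Implicit Arguments.
Unset Strict Implicit.
Unset Printing Implicit Defensive.

Import Order.TTheory.
Local Open Scope classical_set_scope.
Local Open Scope order_scope.

(** * Joins, meets and Scott open sets inside a principal ideal *)

(** The join of [y] and [w] in [ideal r] enters only through its upper bounds, so no join operation
    has to be chosen. *)
Definition le_join {d} {T : porderType d} (r v y w : T) :=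
  forall t, t <= r -> y <= t -> w <= t -> v <= t.

(* In an L-dcpo this says that [x = \sup_(e in D) (x /\ e)] whenever
   [x <= \sup D]. *)
Definition meet_sup d (T : porderType d) :=
  forall (x : T) (D : set T) (s : T), directed D -> isLub D s -> x <= s ->
    isLub (ideal x `&` down D) x.

Section Poset.
Context {d : Order.disp_t} {T : porderType d}.
Implicit Types (x y r s t u v w : T) (A B D U : set T).

Lemma scott_open_not_ideal y : scott_open (~` ideal y).
Proof.
split=> [a b nay ab|D s dirD [ubs leastD] nsy].
  by move=> /(le_trans ab).
apply: contrapT => nD; apply: nsy; apply: leastD => e De.
by apply: contrapT => ney; apply: nD; exists e.
Qed.

(* The complement of [ideal y] is a Scott open set missing
   [ideal x `&` down D] as soon as [y] bounds that set. *)
Lemma meet_continuous_sup : meet_continuous T -> meet_sup T.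
Proof.
move=> mc x D s dirD Ds xs; split=> [z [zx _]//|y uby].
apply: contrapT => nxy.
have /(_ (~` ideal y)) [|z [[zx Dz] nzy]] := mc x D s dirD Ds xs.
  by apply: open_nbhs_nbhs; split=> //; exact: scott_open_not_ideal.
by apply: nzy; exact: uby.
Qed.

Lemma complete_lattice_meet r x y : complete_lattice (ideal r) ->
  x <= r -> y <= r ->
  exists z, [/\ z <= x, z <= y & forall t, t <= x -> t <= y -> t <= z].
Proof.
move=> cl xr yr; have [|_ [m [[_ lbm] ubm]]] := cl [set x; y].
  by move=> _ [->|->].
exists m; split; [by apply: lbm; left|by apply: lbm; right|].
move=> t tx ty; apply: ubm; split; first exact: le_trans tx xr.
by move=> _ [->|->].
Qed.

Lemma complete_lattice_bottom r : complete_lattice (ideal r) ->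
  exists2 b, b <= r & forall t, t <= r -> b <= t.
Proof.
move=> cl; have [//|[b [[br _] lbb]] _] := cl set0.
by exists b => // t tr; apply: lbb; split.
Qed.

(** Members below [e] and [e'] lie below the meet of [x] with a common bound of [e] and [e'] in
    [D]. *)
Lemma directed_ideal_down r x D s : complete_lattice (ideal r) -> s <= r ->
  directed D -> isLub D s -> x <= s -> directed (ideal x `&` down D).
Proof.
move=> cl sr [[e0 De0] dirD] [ubs _] xs.
have xr := le_trans xs sr; have Dr e : D e -> e <= r.
  by move=> De; apply: le_trans sr; exact: ubs.
split.
  have [z [zx ze _]] := complete_lattice_meet cl xr (Dr _ De0).
  by exists z; split=> //; exists e0.
move=> a b [ax [e [De ae]]] [bx [e' [De' be']]].
have [e'' [De'' ee'' e'e'']] := dirD e e' De De'.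
have [z [zx ze zm]] := complete_lattice_meet cl xr (Dr _ De'').
exists z; split; first by split=> //; exists e''.
  by apply: zm => //; exact: le_trans ae ee''.
by apply: zm => //; exact: le_trans be' e'e''.
Qed.

Lemma scott_open_meet r U x D s : meet_sup T ->
  complete_lattice (ideal r) -> s <= r -> scott_open U ->
  directed D -> isLub D s -> x <= s -> U x ->
  exists2 w, U w & w <= x /\ down D w.
Proof.
move=> ms cl sr [_ oU] dirD Ds xs Ux.
have dirx := directed_ideal_down cl sr dirD Ds xs.
have [] := oU _ x dirx (ms _ _ _ dirD Ds xs) Ux.
by move=> w [[wx Dw] Uw]; exists w.
Qed.

(** * Scott open filters in a countable principal ideal *)

(* Stage [(v, y)] passes to some [w] witnessing [~ v <= y \/ w] if there is
   one below the current element. *)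
Lemma generic_chain r U : countable (ideal r) -> U r ->
  exists u : nat -> T, [/\ u 0%N = r, forall n, U (u n),
    forall n m, (n <= m)%N -> u m <= u n &
    forall v y, v <= r -> y <= r ->
      (exists n, ~ le_join r v y (u n)) \/
      (exists n, forall w, U w -> w <= u n -> le_join r v y w)].
Proof.
move=> /countable_injP[g injg] Ur.
(* Injectivity on pairs from [ideal r] makes each stage treat at most one pair. *)
pose code v y := pickle (g v, g y).
have step (mx : nat * T) : exists w, U mx.2 -> [/\ U w, w <= mx.2 &
    forall v y, v <= r -> y <= r -> code v y = mx.1 ->
      ~ le_join r v y w \/
      (forall w', U w' -> w' <= mx.2 -> le_join r v y w')].
  case: mx => m x /=.
  have [[v [y [w [vr yr cm [Uw wx nvyw]]]]]|none] := pselect (exists v y w,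
      [/\ v <= r, y <= r, code v y = m & [/\ U w, w <= x & ~ le_join r v y w]]).
    exists w => Ux; split=> // v' y' v'r y'r cm'.
    have [ev ey] : (g v', g y') = (g v, g y).
      by apply: (pcan_inj pickleK); rewrite -/(code v' y') cm' -cm.
    have -> : v' = v by apply: injg => //; rewrite inE.
    by have -> : y' = y by [apply: injg => //; rewrite inE]; left.
  exists x => Ux; split=> // v y vr yr cm; right=> w Uw wx.
  by apply: contrapT => nvyw; apply: none; exists v, y, w.
have [next nextP] := choice step.
pose u := fix u n := if n is m.+1 then next (m, u m) else r.
have Uu n : U (u n) by elim: n => //= n /(nextP (n, _))[].
have decu n m : (n <= m)%N -> u m <= u n.
  move=> /subnK <-; elim: (m - n)%N => //= k IH.
  by apply: le_trans IH; have [] := nextP (k + n, _)%N (Uu (k + n)%N).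
exists u; split=> // v y vr yr.
have [_ _ /(_ v y vr yr erefl)] := nextP (code v y, _) (Uu (code v y)).
by case=> ?; [left; exists (code v y).+1|right; exists (code v y)].
Qed.

(** Cantor's diagonal argument. *)
Lemma no_injection_set_nat (h : set nat -> nat) : ~ injective h.
Proof.
move=> injh; pose A := [set n | exists2 B, h B = n & ~ B n].
have nA : ~ A (h A) by move=> AhA; have [B /injh ->] := AhA.
by apply: (nA); exists A.
Qed.

(* If [j] is in [A] but not in [B], then [t j] bounds the supremum of [p] over
   [B] but not the one over [A]. *)
Lemma uncountable_sups r (p t : nat -> T) : complete_lattice (ideal r) ->
  (forall j, t j <= r) -> (forall j, p j <= r) ->
  (forall i j, i != j -> p i <= t j) -> (forall j, ~ p j <= t j) ->
  ~ countable (ideal r).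
Proof.
move=> cl tr pr pt npt /countable_injP[g injg].
have supP (A : set nat) : exists s, s <= r /\
    forall t, t <= r -> (s <= t <-> forall j, A j -> p j <= t).
  have [|[s [[sr ubs] lbs]] _] := cl [set p j | j in A].
    by move=> _ [j _ <-]; exact: pr.
  exists s; split=> // x xr; split=> [sx j Aj|ubx].
    by apply: le_trans sx; apply: ubs; exists j.
  by apply: lbs; split=> // _ [j /ubx ? <-].
have [sup {}supP] := choice supP.
have sub (A B : set nat) : sup A = sup B -> A `<=` B.
  move=> AB j Aj; apply: contrapT => nBj; apply: (npt j).
  have [_ supA] := supP A; have [_ supB] := supP B.
  apply: (proj1 (supA _ (tr j))) => //; rewrite AB.
  apply/(supB _ (tr j)) => i Bi; apply: pt.
  by apply: contra_notN nBj => /eqP <-.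
apply: (@no_injection_set_nat (g \o sup)) => A B /= gAB.
have AB : sup A = sup B.
  by apply: injg => //; rewrite inE; exact: (supP _).1.
by apply/seteqP; split; apply: sub.
Qed.

Lemma scott_open_filter r U : meet_sup T -> complete_lattice (ideal r) ->
  countable (ideal r) -> scott_open U -> U r ->
  exists F : set T, [/\ F r, F `<=` U,
    forall x y, F x -> F y -> exists z, [/\ F z, z <= x & z <= y] &
    forall D s, directed D -> isLub D s -> F s -> D `&` F !=set0].
Proof.
move=> ms cl cr oU Ur; have [u [u0 Uu decu genu]] := generic_chain cr Ur.
have ur n : u n <= r by rewrite -u0 decu.
exists [set x | x <= r /\ exists n, u n <= x]; split.
- by split=> //; exists 0%N; exact: ur.
- by move=> x [_ [n]]; exact: oU.1.
- move=> x y [_ [n unx]] [_ [m umy]]; exists (u (maxn n m)); split.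
  + by split=> //; exists (maxn n m).
  + by apply: le_trans unx; rewrite decu ?leq_maxl.
  + by apply: le_trans umy; rewrite decu ?leq_maxr.
move=> D s dirD Ds [sr [n0 uns]]; apply: contrapT => miss.
have us n : (n0 <= n)%N -> u n <= s by move=> /decu/le_trans; apply.
have Dr e : D e -> e <= r by move=> De; apply: le_trans sr; exact: Ds.1.
have uD n e : D e -> ~ u n <= e.
  move=> De une; apply: miss; exists e.
  by split=> //; split; [exact: Dr|exists n].
(* Otherwise some [w] in [U], below [u m] and below a member of [D], would place [u n] below a
   member of [D], against [uD]. *)
have notjoin n e : D e -> exists m, ~ le_join r (u n) e (u m).
  move=> De; have [//|[m joinm]] := genu (u n) e (ur n) (Dr e De).
  have [w Uw [wm [e' [De' we']]]] := scott_open_meet ms cl sr oU dirD Ds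
    (us _ (leq_maxr m n0)) (Uu (maxn m n0)).
  have [e'' [De'' ee'' e'e'']] := dirD.2 e e' De De'.
  case: (uD n e'' De''); apply: (joinm w Uw _ _ (Dr _ De'') ee'').
    by apply: le_trans wm _; rewrite decu ?leq_maxl.
  exact: le_trans we' e'e''.
have step (me : nat * T) : exists q : (nat * T) * (T * T),
    (n0 <= me.1)%N -> D me.2 ->
    [/\ [/\ (me.1 < q.1.1)%N, D q.1.2 & me.2 <= q.1.2],
        [/\ q.2.1 <= u me.1 & q.2.1 <= q.1.2] &
        [/\ q.2.2 <= r, me.2 <= q.2.2, u q.1.1 <= q.2.2 & ~ q.2.1 <= q.2.2]].
  case: me => m e /=.
  have [[n0m De]|nD] := pselect ((n0 <= m)%N /\ D e); last first.
    (* Dummy values: the premises fail here. *)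
    by exists ((m, e), (e, e)) => ? ?; case: nD.
  have [m' /existsNP[t /not_implyP[tr /not_implyP[et /not_implyP[m't mt]]]]] :=
    notjoin m e De.
  (* [u m] is the supremum of the elements below both it and a member of [D]; since [u m] is not
     below [t], one of them is not. *)
  have [p [[pm [e' [De' pe']]] npt]] :
      exists p, (ideal (u m) `&` down D) p /\ ~ p <= t.
    apply: contrapT => nop; apply: mt.
    apply: (ms _ _ _ dirD Ds (us m n0m)).2 => p Dp.
    by apply: contrapT => npt; apply: nop; exists p.
  have [e'' [De'' ee'' e'e'']] := dirD.2 e e' De De'.
  exists ((maxn m.+1 m', e''), (p, t)) => _ _ /=; split; split=> //.
  + exact: leq_maxl.
  + exact: le_trans pe' e'e''.
  + by apply: le_trans m't; rewrite decu ?leq_maxr.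
have [next nextP] := choice step.
have [e0 De0] := dirD.1.
pose me j := iter j (fun q => (next q).1) (n0, e0).
have meP j : (n0 <= (me j).1)%N /\ D (me j).2.
  elim: j => //= j [n0j Dj]; have [[lt De _] _ _] := nextP _ n0j Dj.
  by split=> //; exact: leq_trans (ltnW lt).
have meS j := nextP _ (meP j).1 (meP j).2.
have lem i j : (i <= j)%N -> ((me i).1 <= (me j).1)%N.
  move=> /subnK <-; elim: (j - i)%N => //= k IH.
  by apply: leq_trans IH _; have [[/ltnW]] := meS (k + i)%N.
have lee i j : (i <= j)%N -> (me i).2 <= (me j).2.
  move=> /subnK <-; elim: (j - i)%N => //= k IH.
  by apply: le_trans IH _; have [[]] := meS (k + i)%N.
pose p j := (next (me j)).2.1; pose t j := (next (me j)).2.2.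
apply: (@uncountable_sups r p t) => // [j|j|i j|j].
- by have [_ _ []] := meS j.
- by have [_ [/le_trans + _] _] := meS j; apply.
(* For [i < j], [p i] is below the [D]-component of stage [i.+1], hence below that of stage [j]. For
   [j < i], it is below the [u]-term of stage [i], hence below that of stage [j.+1]. Both are
   bounded by [t j]. *)
- have [_ [piu pie] _] := meS i; have [_ _ [_ et ut _]] := meS j.
  rewrite neq_ltn => /orP[ij|ji].
    by apply: le_trans pie _; apply: le_trans et; exact: lee ij.
  apply: le_trans piu _; apply: le_trans ut; apply: decu; exact: lem ji.
- by have [_ _ []] := meS j.
Qed.
End Poset.

Lemma dependent_function_choice (I : Type) (T : I -> Type)
    (R : forall i, T i -> Prop) :
  (forall i, exists x, R i x) -> exists f : forall i, T i, forall i, R i (f i).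
Proof.
by move=> exR; exists (fun i => sval (cid (exR i))) => i; exact: svalP.
Qed.

(** * Products: suprema, meets and box neighbourhoods *)

Section Product.
Context {d : Order.disp_t} {I : choiceType} {P : I -> porderType d}.
Implicit Types (f g h r : prod_order P) (D U : set (prod_order P)).

Lemma prod_leP f g : reflect (forall i, f i <= g i) (f <= g).
Proof. exact: asboolP. Qed.

Lemma directed_proj D i : directed D -> directed [set f i | f in D].
Proof.
move=> [[f Df] dirD]; split; first by exists (f i), f.
move=> _ _ [g Dg <-] [h Dh <-].
have [k [Dk /prod_leP gk /prod_leP hk]] := dirD g h Dg Dh.
by exists (k i); split=> //; exists k.
Qed.

Lemma prod_isLubP D f :
  isLub D f <-> forall i, isLub [set g i | g in D] (f i).
Proof.
split=> [[ubf leastf] i|lubf].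
  split=> [_ [g Dg <-]|y uby]; first by have /prod_leP := ubf g Dg.
  (* Replacing the coordinate [i] of [f] by [y] still gives an upper bound. *)
  have /leastf/prod_leP/(_ i) : ubound D (dfwith f y : prod_order P).
    move=> g Dg; apply/prod_leP => j; case: dfwithP => [|k _].
      by apply: uby; exists g.
    by have /prod_leP := ubf g Dg.
  by rewrite dfwith_in.
split=> [g Dg|g ubg]; apply/prod_leP => i.
  by apply: (lubf i).1; exists g.
by apply: (lubf i).2 => _ [h Dh <-]; have /prod_leP := ubg h Dh.
Qed.

Lemma prod_complete_lattice r :
  (forall i, complete_lattice (ideal (r i))) -> complete_lattice (ideal r).
Proof.
move=> cl B Br.
have Bri i : [set g i | g in B] `<=` ideal (r i).
  by move=> _ [g Bg <-]; exact: (prod_leP _ _ (Br g Bg)).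
have [s sP] := dependent_function_choice (fun i => (cl i _ (Bri i)).1).
have [m mP] := dependent_function_choice (fun i => (cl i _ (Bri i)).2).
split; [exists s|exists m]; split.
- split; first by apply/prod_leP => i; have [[]] := sP i.
  move=> g Bg; apply/prod_leP => i.
  by have [[_ ubs] _] := sP i; apply: ubs; exists g.
- move=> g [/prod_leP gr ubg]; apply/prod_leP => i.
  have [_ lbs] := sP i; apply: lbs; split=> [|_ [h Bh <-]]; first exact: gr.
  by have /prod_leP := ubg h Bh.
- split; first by apply/prod_leP => i; have [[]] := mP i.
  move=> g Bg; apply/prod_leP => i.
  by have [[_ lbm] _] := mP i; apply: lbm; exists g.
- move=> g [/prod_leP gr lbg]; apply/prod_leP => i.
  have [_ ubm] := mP i; apply: ubm; split=> [|_ [h Bh <-]]; first exact: gr.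
  by have /prod_leP := lbg h Bh.
Qed.

(** The coordinatewise meet of [f] and a member [e] of [D] dominates, at [i], every common lower
    bound of [f i] and [e i]. *)
Lemma prod_meet_sup : (forall i (x : P i), complete_lattice (ideal x)) ->
  (forall i, meet_sup (P i)) -> meet_sup (prod_order P).
Proof.
move=> cl ms f D s dirD Ds fs; split=> [g [gf _]//|y uby].
apply/prod_leP => i; move: fs => /prod_leP fs.
have Dsi := (prod_isLubP D s).1 Ds i.
apply: (ms i _ _ _ (directed_proj i dirD) Dsi (fs i)).2.
move=> z [zf [_ [[e De <-] ze]]].
have /prod_leP es := Ds.1 e De.
have [m mP] := dependent_function_choice
  (fun j => complete_lattice_meet (cl j _) (fs j) (es j)).
have /uby/prod_leP/(_ i) : (ideal f `&` down D) (m : prod_order P).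
  split; first by apply/prod_leP => j; have [] := mP j.
  by exists e; split=> //; apply/prod_leP => j; have [] := mP j.
by apply: le_trans; have [_ _] := mP i; apply.
Qed.

Lemma prod_topology_openP (A : set (prod_topology (fun i => scott (P i)))) :
  open A <-> forall f, A f -> exists s : seq I, exists V : forall i, set (P i),
    [/\ forall i, scott_open (V i), forall i, V i (f i) &
      forall g, (forall i, i \in s -> V i (g i)) -> A g].
Proof.
split=> [oA f Af|A_box].
  (* The sets containing a box around [f] form a filter that converges to [f] in each coordinate,
     hence in the product. *)
  pose F : set_system (prod_topology (fun i => scott (P i))) :=
    [set B | exists s : seq I, exists V : forall i, set (P i),
      [/\ forall i, scott_open (V i), forall i, V i (f i) &
        forall g, (forall i, i \in s -> V i (g i)) -> B g]].
  have FF : Filter F.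
    split.
    - by exists [::], (fun=> setT); split=> // i; exact: scott_openT.
    - move=> B C [s [V [oV Vf VB]]] [s' [V' [oV' Vf' VC]]].
      exists (s ++ s'), (fun i => V i `&` V' i); split=> // [i|g gV].
        exact: scott_openI.
      split; [apply: VB|apply: VC] => i si.
        by have [] := gV i; rewrite // mem_cat si.
      by have [] := gV i; rewrite // mem_cat si orbT.
    - move=> B C BC [s [V [oV Vf VB]]]; exists s, V; split=> // g gV.
      by apply: BC; exact: VB.
  have Ff : F --> (f : prod_topology (fun i => scott (P i))).
    apply/cvg_sup => i B [C [[V oV <-] Vf CB]].
    exists [:: i], (@dfwith I (fun i => set (P i)) (fun=> setT) i V).
    split=> [j|j|g gV].
    - by case: dfwithP => // k _; exact: scott_openT.
    - by case: dfwithP.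
    - by apply: CB; have := gV i; rewrite dfwith_in inE eqxx; apply.
  by apply: (Ff A); apply: open_nbhs_nbhs.
rewrite openE => f /A_box[s [V [oV Vf VA]]].
apply: (@filterS _ _ _ [set g | forall i, i \in s -> V i (g i)]) => //.
elim: s {VA} => [|i s IH]; first by apply: filterS filterT.
have Vi : nbhs f ((fun g => g i) @^-1` V i).
  apply: (@proj_continuous I (fun i => scott (P i)) i).
  by apply: open_nbhs_nbhs; split=> //; exact: oV.
apply: filterS (filterI Vi IH) => g [Vg sg] j.
by rewrite inE => /predU1P[->|/sg].
Qed.

(** A box constrains finitely many coordinates, so directedness gathers the conditions into one
    member of [D]. *)
Lemma prod_open_scott_open (A : set (prod_order P)) :
  @open (prod_topology (fun i => scott (P i))) A -> scott_open A.
Proof.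
move=> /prod_topology_openP A_box; split.
  move=> f g /A_box[s [V [oV Vf VA]]] /prod_leP fg.
  by apply: VA => i _; exact: (oV i).1 (Vf i) (fg i).
move=> D f dirD Df /A_box[s [V [oV Vf VA]]].
suff [g [Dg gV]] : exists g, D g /\ forall i, i \in s -> V i (g i).
  by exists g; split=> //; exact: VA.
elim: s {VA} => [|i s [g [Dg gV]]]; first by have [g Dg] := dirD.1; exists g.
have [_ [[h Dh <-] Vh]] := (oV i).2 _ _ (directed_proj i dirD)
  ((prod_isLubP D f).1 Df i) (Vf i).
have [k [Dk /prod_leP gk /prod_leP hk]] := dirD.2 g h Dg Dh.
exists k; split=> // j; rewrite inE => /predU1P[->|/gV Vg].
  exact: (oV i).1 Vh (hk i).
exact: (oV j).1 Vg (gk j).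
Qed.

Lemma dfwith_le r i (x y : P i) :
  x <= y -> (dfwith r x : prod_order P) <= dfwith r y.
Proof.
move=> xy; apply/prod_leP => j; case: (eqVneq i j) => [<-|ij].
  by rewrite !dfwith_in.
by rewrite !dfwith_out.
Qed.

Lemma directed_dfwith r i (E : set (P i)) : directed E ->
  directed [set (dfwith r x : prod_order P) | x in E].
Proof.
move=> [[x Ex] dirE]; split; first by exists (dfwith r x), x.
move=> _ _ [y Ey <-] [z Ez <-]; have [t [Et yt zt]] := dirE y z Ey Ez.
by exists (dfwith r t); split; [exists t|exact: dfwith_le|exact: dfwith_le].
Qed.

Lemma isLub_dfwith r i (E : set (P i)) y : E !=set0 -> isLub E y ->
  isLub [set (dfwith r x : prod_order P) | x in E] (dfwith r y).
Proof.
move=> [x0 Ex0] [ubE leastE]; split=> [_ [x Ex <-]|g ubg].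
  by apply: dfwith_le; exact: ubE.
apply/prod_leP => j; case: (eqVneq i j) => [<-|ij].
  rewrite dfwith_in; apply: leastE => x Ex.
  have /prod_leP/(_ i) : (dfwith r x : prod_order P) <= g.
    by apply: ubg; exists x.
  by rewrite dfwith_in.
have /prod_leP/(_ j) : (dfwith r x0 : prod_order P) <= g.
  by apply: ubg; exists x0.
by rewrite !dfwith_out.
Qed.

(** [y] is the directed supremum of the elements below it and below [D]; [dfwith r] preserves this
    supremum, so [F] contains some [dfwith r e] with [e] below a member of [D]. *)
Lemma scott_open_slice r i (F : set (prod_order P)) :
  (forall x : P i, complete_lattice (ideal x)) -> meet_sup (P i) ->
  (forall D s, directed D -> isLub D s -> F s -> D `&` F !=set0) ->
  scott_open [set x | exists y : P i, [/\ y <= x, y <= r i & F (dfwith r y)]].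
Proof.
move=> cl ms oF; split.
  by move=> x x' [y [yx yr Fy]] xx'; exists y; split=> //; exact: le_trans xx'.
move=> D s dirD Ds [y [ys yr Fy]].
have dirE := directed_ideal_down (cl s) (lexx s) dirD Ds ys.
have Ey := ms _ _ _ dirD Ds ys.
have [_ [[e [ey [x [Dx ex]]] <-] Fe]] :=
  oF _ _ (directed_dfwith r dirE) (isLub_dfwith r dirE.1 Ey) Fy.
by exists x; split=> //; exists e; split=> //; exact: le_trans yr.
Qed.

(** * Sufficiency: Scott open sets are Tychonoff open *)

Lemma scott_open_prod_open (W : set (prod_order P)) :
  (forall i, countable [set: P i]) ->
  (forall i (x : P i), complete_lattice (ideal x)) ->
  (forall i, meet_sup (P i)) ->
  finite_set [set i | ~ has_least (P i)] ->
  scott_open W -> @open (prod_topology (fun i => scott (P i))) W.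
Proof.
move=> countP cl ms /finite_seqP[s0 I0E] oW; apply/prod_topology_openP => f Wf.
have [b b_least] : exists b : prod_order P,
    forall i, i \notin s0 -> forall x, b i <= x.
  apply: (@dependent_function_choice _ _
    (fun i b => i \notin s0 -> forall x, b <= x)) => i.
  (* On [s0] the value [f i] is a mere default. *)
  have [is0|nis0] := boolP (i \in s0); first by exists (f i).
  have : ~ [set` s0] i by move=> /= is0; rewrite is0 in nis0.
  by rewrite -I0E /= => /contrapT[x xP]; exists x.
pose trunc (s : seq I) : prod_order P := fun i => if i \in s then f i else b i.
have trunc_le s t : {subset s0 <= s} -> {subset s <= t} -> trunc s <= trunc t.
  move=> s0s st; apply/prod_leP => i; rewrite /trunc.
  case: ifPn => [/st ->//|nis]; apply: b_least.
  by apply: contra nis; exact: s0s.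
have truncf s : {subset s0 <= s} -> trunc s <= f.
  move=> s0s; apply/prod_leP => i; rewrite /trunc.
  case: ifPn => // nis; apply: b_least.
  by apply: contra nis; exact: s0s.
have [_ [[s s0s <-] Wr]] :
    [set trunc s | s in [set s | {subset s0 <= s}]] `&` W !=set0.
  apply: oW.2 Wf; split.
  - by exists (trunc s0), s0.
  - move=> _ _ [s s0s <-] [t s0t <-]; exists (trunc (s ++ t)).
    split; first by exists (s ++ t) => // i /s0s; rewrite mem_cat => ->.
      by apply: trunc_le => // i; rewrite mem_cat => ->.
    by apply: trunc_le => // i; rewrite mem_cat orbC => ->.
  - by move=> _ [s s0s <-]; exact: truncf.
  - move=> g ubg; apply/prod_leP => i.
    have /prod_leP/(_ i) : trunc (i :: s0) <= g.
      by apply: ubg; exists (i :: s0) => // j; rewrite inE orbC => ->.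
    by rewrite /trunc mem_head.
set r := trunc s in Wr.
have r_least i x : i \notin s -> r i <= x.
  move=> nis; rewrite /r /trunc (negbTE nis); apply: b_least.
  by apply: contra nis; exact: s0s.
(* Below [r] the coordinates outside [s] are forced to be least, so the finite list of those in [s]
   determines an element. *)
have count_r : countable (ideal r).
  have [c injc] :=
    dependent_function_choice (fun i => elimT (countable_injP _) (countP i)).
  apply/countable_injP; exists (fun g => pickle [seq c i (g i) | i <- s]).
  move=> g h; rewrite !inE => /prod_leP gr /prod_leP hr.
  move=> /(pcan_inj pickleK) /eq_in_map gh.
  apply: functional_extensionality_dep => i.
  have [/gh|nis] := boolP (i \in s); first by apply: injc; rewrite inE.
  apply: le_anti.
  by rewrite (le_trans (gr i)) ?r_least// (le_trans (hr i)) ?r_least.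
have [F [Fr FW meetF oF]] := scott_open_filter (prod_meet_sup cl ms)
  (prod_complete_lattice (fun i => cl i (r i))) count_r oW Wr.
exists s, (fun i => [set x | exists y : P i,
  [/\ y <= x, y <= r i & F (dfwith r y)]]); split=> [i|i|g gV].
- exact: scott_open_slice.
- exists (r i); split=> //; first exact: (prod_leP _ _ (truncf s s0s)).
  suff -> : (dfwith r (r i) : prod_order P) = r by [].
  by apply: functional_extensionality_dep => j; case: dfwithP.
have [z [Fz /prod_leP zr zg]] :
    exists z, [/\ F z, z <= r & forall i, i \in s -> z i <= g i].
  (* The induction runs over sublists of [s], with [s] itself fixed, and meets [z] with one slice
     element at a time. *)
  elim: {-2}s (fun i (is_ : i \in s) => is_) => [|i t IH] st.
    by exists r.
  have [|z [Fz zr zg]] := IH.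
    by move=> j jt; apply: st; rewrite inE jt orbT.
  have [y [yg _ Fy]] := gV i (st i (mem_head _ _)).
  have [z' [Fz' z'z /prod_leP z'y]] := meetF _ _ Fz Fy.
  exists z'; split=> //; first exact: le_trans zr.
  move=> j; rewrite inE => /predU1P[->|/zg]; last first.
    by apply: le_trans; exact: (prod_leP _ _ z'z).
  by apply: le_trans yg; have := z'y i; rewrite dfwith_in.
apply: oW.1 (FW _ Fz) _; apply/prod_leP => i.
have [/zg//|nis] := boolP (i \in s).
by apply: le_trans (zr i) _; exact: r_least.
Qed.

(** * Necessity: filters generated by minimal elements *)

(** Both [a i] and [f i] lie below [s i], whose ideal has a least element; by minimality [a i] is
    below it, hence below [f i]. *)
Lemma scott_open_minimal (a : prod_order P) :
  (forall i (x : P i), complete_lattice (ideal x)) ->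
  (forall i (x : P i), x <= a i -> a i <= x) ->
  scott_open [set f | a <= f].
Proof.
move=> cl mina; split; first by move=> f g /= /le_trans; apply.
move=> D s [[f Df] _] [ubs _] /prod_leP as_; exists f; split=> //=.
apply/prod_leP => i; have [b bs bl] := complete_lattice_bottom (cl i (s i)).
apply: le_trans (mina i b (bl _ (as_ i))) _; apply: bl.
exact: (prod_leP _ _ (ubs f Df)).
Qed.

Lemma scott_prod_eq_finite : (forall i, [set: P i] !=set0) ->
  (forall i (x : P i), complete_lattice (ideal x)) ->
  scott_prod_eq P -> finite_set [set i | ~ has_least (P i)].
Proof.
move=> neP cl eqP_.
have [a mina] : exists a : prod_order P, forall i x, x <= a i -> a i <= x.
  apply: (@dependent_function_choice _ _
    (fun i a => forall x, x <= a -> a <= x)).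
  move=> i; have [x0 _] := neP i.
  have [b bx bl] := complete_lattice_bottom (cl i x0).
  by exists b => x xb; apply: bl; exact: le_trans bx.
have [c nac] : exists c : prod_order P,
    forall i, ~ has_least (P i) -> ~ a i <= c i.
  apply: (@dependent_function_choice _ _
    (fun i c => ~ has_least (P i) -> ~ a i <= c)) => i.
  have [least|/existsNP[x nax]] := pselect (forall x, a i <= x).
    by exists (a i); case; exists (a i).
  by exists x.
have : @open (prod_topology (fun i => scott (P i))) [set f | a <= f].
  by rewrite -eqP_; exact: scott_open_minimal.
move=> /prod_topology_openP /(_ a (lexx a)) [s [V [_ Va VU]]].
apply: (@sub_finite_set _ _ [set` s]) => // i /= nleast.
apply: contrapT => nis; apply: (nac i nleast).
(* Changing [a] to [c i] at a coordinate outside [s] does not leave the box. *)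
have /VU/prod_leP/(_ i) : forall j, j \in s -> V j (dfwith a (c i) j).
  by move=> j js; rewrite dfwith_out //; apply: contra_notN nis => /eqP ->.
by rewrite dfwith_in.
Qed.
End Product.

Theorem theorem7p3 (d : Order.disp_t) (I : Type) :
  (forall P : I -> porderType d,
     (forall i, [set: P i] !=set0) ->
     (forall i, countable [set: P i]) ->
     (forall i, L_dcpo (P i)) ->
     (forall i, meet_continuous (P i)) ->
     scott_prod_eq P <-> finite_set [set i | ~ has_least (P i)]) /\
  (forall P : I -> porderType d,
     (forall i, [set: P i] !=set0) ->
     (forall i, L_dcpo (P i)) ->
     scott_prod_eq P -> finite_set [set i | ~ has_least (P i)]).
Proof.
have necessity (P : I -> porderType d) : (forall i, [set: P i] !=set0) ->
    (forall i, L_dcpo (P i)) ->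
    scott_prod_eq P -> finite_set [set i | ~ has_least (P i)].
  (* [{classic I}] equips the arbitrary index type with a choice structure. *)
  move=> neP LP; apply: (@scott_prod_eq_finite d {classic I} P neP) => i.
  exact: (LP i).2.
split=> // P neP countP LP mcP; split; first exact: necessity.
move=> finI0; apply/funext => A; apply/propext; split.
  apply: (@scott_open_prod_open d {classic I} P) => // i; first exact: (LP i).2.
  exact: meet_continuous_sup.
exact: (@prod_open_scott_open d {classic I} P).
Qed.
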